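(* Let $D>1$ be a squarefree integer, let $K=\mathbb{Q}(\sqrt D)\subset\mathbb{R}$ be the corresponding real quadratic field, and let $$\xi_D=\begin{cases}\sqrt D, & D\equiv 2,3\pmod 4,\\ \dfrac{\sqrt D-1}{2}, & D\equiv 1\pmod 4.\end{cases}$$ Let $\xi_D=[u_0,\overline{u_1,\dots,u_s}]$ be the periodic continued fraction expansion of $\xi_D$, with minimal period length $s$. Let $I=(\alpha)$ be a principal fractional ideal of $K$ for some $\alpha\in K$, $\alpha>0$, and let $\alpha'$ be the conjugate of $\alpha$ over $\mathbb{Q}$. Then $$\kappa(I)\le\begin{cases}u_1+u_2+u_3+\dots+u_{s-1}+u_s & \text{if } s \text{ is odd},\\ u_1+u_3+\dots+u_{s-1} & \text{if } s \text{ is even and } \alpha'>0,\\ u_2+u_4+\dots+u_s & \text{if } s \text{ is even and } \alpha'<0.\end{cases}$$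
   Context: An element of $K$ is totally positive if both it and its conjugate are positive real numbers. For a subset $J\subseteq K$, $J^+$ is the set of totally positive elements of $J$, and $J^{+,0}=J^+\cup\{0\}$. $\mathcal{O}_K$ is the ring of integers of $K$. For a nonzero fractional ideal $I$ of $\mathcal{O}_K$, $\kappa(I)$ is the smallest number $n$ such that there exist $\alpha_1,\dots,\alpha_n\in K^+$ with $$I^{+,0}=\alpha_1\mathcal{O}_K^{+,0}+\dots+\alpha_n\mathcal{O}_K^{+,0}.$$ The overline in $[u_0,\overline{u_1,\dots,u_s}]$ denotes the repeating block of the simple continued fraction. *)

(* Defs.v *)
From mathcomp Require Import all_boot all_order all_algebra.
From mathcomp Require Import all_classical all_reals.
Set Implicit Arguments.
Unset Strict Implicit.
Unset Printing Implicit Defensive.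
Import Order.TTheory GRing.Theory Num.Theory.
Local Open Scope classical_set_scope.
Local Open Scope ring_scope.

Definition squarefree (D : nat) : Prop := forall d : nat, (d ^ 2 %| D)%N -> d = 1%N.

Section QuadraticField.
Variables (R : realType) (D : nat).

Definition quad (a b : rat) : R := ratr a + ratr b * Num.sqrt D%:R.

Definition quadratic_field : set R := [set x | exists a b : rat, x = quad a b].

(* The conjugate of x over rat; the pair (a, b), hence the conjugate, is unique
   when D is not a square, and the value outside quadratic_field is junk. *)
Definition conjugate (x : R) : R :=
  xget 0 [set y | exists a b : rat, x = quad a b /\ y = quad a (- b)].

Definition ring_of_integers : set R :=
  [set x | quadratic_field x /\ integralOver (intr : int -> R) x].

Definition totally_positive (J : set R) : set R :=
  [set x | [/\ J x, 0 < x & 0 < conjugate x]].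

Definition totally_positive0 (J : set R) : set R :=
  totally_positive J `|` [set 0].

(* alpha * O_K *)
Definition principal_ideal (alpha : R) : set R :=
  [set alpha * x | x in ring_of_integers].

Definition generated_by (I : set R) (n : nat) : Prop :=
  exists alpha : 'I_n -> R,
    (forall i, totally_positive quadratic_field (alpha i)) /\
    totally_positive0 I =
      [set y | exists x : 'I_n -> R,
         (forall i, totally_positive0 ring_of_integers (x i)) /\
         y = \sum_(i < n) alpha i * x i].

Definition is_kappa (I : set R) (k : nat) : Prop :=
  generated_by I k /\ forall n, generated_by I n -> (k <= n)%N.

Definition xi : R :=
  if (D %% 4 == 1)%N then (Num.sqrt D%:R - 1) / 2 else Num.sqrt D%:R.

End QuadraticField.

Section ContinuedFraction.
Variable R : realType.

(* If x is rational the expansion terminates: some fractional part is 0, and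
   since 0^-1 = 0 all later quotients are 0. *)
Fixpoint complete_quotient (x : R) (n : nat) : R :=
  if n is m.+1 then
    let y := complete_quotient x m in (y - (Num.floor y)%:~R)^-1
  else x.

Definition partial_quotient (x : R) (n : nat) : int :=
  Num.floor (complete_quotient x n).

(* [u 0, u 1, ..., u s, u 1, ..., u s, ...]: u 0 is not in the repeating block. *)
Definition periodic_after0 (u : nat -> int) (s : nat) : Prop :=
  (0 < s)%N /\ forall i, (0 < i)%N -> u (i + s)%N = u i.

Definition minimal_period (u : nat -> int) (s : nat) : Prop :=
  periodic_after0 u s /\ forall t, periodic_after0 u t -> (s <= t)%N.

End ContinuedFraction.

(* Main.v *)
Require Import Defs.
From mathcomp Require Import all_boot all_order all_algebra.
From mathcomp Require Import all_classical all_reals.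
From mathcomp Require Import ring lra zify.
Set Implicit Arguments.
Unset Strict Implicit.
Unset Printing Implicit Defensive.
Import Order.TTheory GRing.Theory Num.Theory.
Local Open Scope classical_set_scope.
Local Open Scope ring_scope.

(* Let omega be the conjugate of - xi, and let A_n = p_{n-1} + q_{n-1} omega,
   where p_n / q_n are the convergents of xi.  The conjugates of the A_n alternate
   in sign, any two consecutive A_n form a basis of O_K over the integers, and
   when T is an even period of the expansion, eps = A_T is a totally positive unit
   with A_{T+n} = eps A_n.  Let y in O_K be positive with conjugate of sign (-1)^e,
   and n = e mod 2.  In y = a A_n + b A_{n+1} one has a > 0; if
   0 <= b <= u_{n+1} a, then y is a sum of elements A_n + r A_{n+1} with
   0 <= r <= u_{n+1}.  Otherwise passing to n + 2 (b too large) or to n - 2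
   (b < 0, after multiplication by eps) decreases the positive integer a.  Hence
   the alpha (A_n + r A_{n+1}) with 0 <= n < T, n = e mod 2, 0 <= r < u_{n+1}
   generate (alpha)^{+,0}, where (-1)^e is the sign of the conjugate of alpha.
   For odd s one takes T = 2s. *)

(** * Integrality of rational numbers and of factors of integer polynomials *)

(** By Gauss's lemma [q] is [c] times an integer factor [q1] of [p]. As [p] is monic, [q1] has
    leading coefficient 1 or -1, and [q] monic then forces [c] to be 1 or -1. *)
Lemma monic_rat_dvd_int (q : {poly rat}) (p : {poly int}) :
  q \is monic -> p \is monic -> q %| map_poly intr p ->
  forall i, q`_i \is a Num.int.
Proof.
move=> qm pm /dvdpP_rat_int [q1 [c c0 qE] [r pE]] i.
have /eqP := congr1 lead_coef pE.
rewrite lead_coefM (monicP pm) eq_sym => /eqP lead1.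
have u1 : (lead_coef q1 == 1) || (lead_coef q1 == -1).
  by move/intUnitRing.unitzPl: (etrans (mulrC _ _) lead1).
have cE : c * (lead_coef q1)%:~R = 1.
  move/monicP: qm; rewrite qE lead_coefZ lead_coef_map_inj //.
  exact: intr_inj.
rewrite qE coefZ coef_map /= rpredM ?rpred_int //.
by case/orP: u1 cE => /eqP ->;
  rewrite ?mulr1 ?mulrN1 => /eqP; rewrite ?eqr_oppLR => /eqP ->;
  rewrite ?rpredN rpred1.
Qed.

(** In lowest terms the squared denominator is coprime to the squared numerator, hence divides
    [D]. *)
Lemma squarefree_rat_int (D : nat) (c : rat) : (0 < D)%N -> squarefree D ->
  D%:R * c ^+ 2 \is a Num.int -> c \is a Num.int.
Proof.
move=> D0 hD /intrP[m mE].
have E : (D%:Z * numq c ^+ 2)%:~R = (m * denq c ^+ 2)%:~R :> rat.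
  by rewrite !intrM -mE numqE -pmulrn; ring.
move/intr_inj: E => /(congr1 absz); rewrite !abszM absz_nat !mulnn => E.
have dD : (`|denq c| ^ 2 %| D)%N.
  rewrite -(@Gauss_dvdl _ _ (`|numq c| ^ 2)); first by rewrite E dvdn_mull.
  by rewrite coprimeXl // coprimeXr // coprime_sym coprime_num_den.
have {dD}/hD d1 := dD.
rewrite -[c]divq_num_den rpredM ?rpred_int //.
by rewrite -[denq c]gez0_abs ?denq_ge0 // d1 invr1 rpred1.
Qed.

(** * The field, its conjugation and the integral basis 1, [omega] *)

Section QuadraticField.
Variables (R : realType) (D : nat).
Hypotheses (hD1 : (1 < D)%N) (hDsf : squarefree D).
Local Notation w := (Num.sqrt D%:R : R).
Local Notation K := (@quadratic_field R D).
Local Notation O := (@ring_of_integers R D).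
Local Notation cj := (conjugate D).
Local Notation q := (@quad R D).

Lemma sqr_sqrtD : w * w = D%:R.
Proof. by rewrite -expr2 sqr_sqrtr ?ler0n. Qed.

Lemma sqrtD_irrational (a : rat) : w != ratr a.
Proof.
apply/eqP => wE; have D0 : D%:R != 0 :> rat by rewrite pnatr_eq0; lia.
have aa : a * a = D%:R.
  by apply: (fmorph_inj (@ratr R)); rewrite rmorphM /= -wE sqr_sqrtD ratr_nat.
(* As [a / D] is the inverse of [a], [squarefree_rat_int] applies to it with the integer 1; an
   integer [m] with [D * m ^ 2 = 1] then contradicts [D > 1]. *)
have E : D%:R * (a / D%:R) ^+ 2 = 1 by rewrite expr2 mulf_div aa mulrA divff // mulf_neq0.
have : (a / D%:R) \is a Num.int.
  by apply: (@squarefree_rat_int D) => //; [lia | rewrite E rpred1].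
case/intrP => m mE; move: E; rewrite mE => /eqP.
rewrite -rmorphXn -[D%:R]/(D%:Z%:~R) -intrM -[1]/(1%:~R) eqr_int => /eqP.
move=> /(congr1 absz); rewrite abszM absz_nat => /eqP.
by rewrite muln_eq1; lia.
Qed.

Lemma quad_inj (a b c d : rat) : q a b = q c d -> a = c /\ b = d.
Proof.
rewrite /quad => E.
have bd : b = d.
  apply/eqP/negPn/negP => bd.
  have /eqP[] := sqrtD_irrational ((a - c) / (d - b)).
  have db0 : ratr d - ratr b != 0 :> R.
    by rewrite subr_eq0 eq_sym (inj_eq (fmorph_inj _)).
  rewrite fmorph_div /= !rmorphB /=; apply: (mulIf db0).
  rewrite divfK //; lra.
split=> //; apply: (fmorph_inj (@ratr R)).
by move: E; rewrite bd => /addIr.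
Qed.

Lemma conj_quad (a b : rat) : cj (q a b) = q a (- b).
Proof.
rewrite /conjugate; case: xgetP => [y _ [c [d [E ->]]]|/(_ (q a (- b)))].
  by have [-> ->] := quad_inj E.
by case; exists a, b.
Qed.

Lemma quadD a b c d : q a b + q c d = q (a + c) (b + d).
Proof. rewrite /quad !rmorphD /=; ring. Qed.

Lemma quadM a b c d :
  q a b * q c d = q (a * c + D%:R * b * d) (a * d + b * c).
Proof.
rewrite /quad !rmorphD /= !rmorphM /= ratr_nat.
by have := sqr_sqrtD; set v := w => <-; ring.
Qed.

Lemma quad_int (m : int) : q m%:~R 0 = m%:~R.
Proof. by rewrite /quad ratr_int rmorph0 mul0r addr0. Qed.

Lemma fieldD x y : K x -> K y -> K (x + y).
Proof.
by case=> a [b ->] [c [d ->]]; rewrite quadD; exists (a + c), (b + d).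
Qed.

Lemma fieldM x y : K x -> K y -> K (x * y).
Proof. by case=> a [b ->] [c [d ->]]; rewrite quadM; do 2!eexists. Qed.

Lemma field_int (m : int) : K m%:~R.
Proof. by exists m%:~R, 0; rewrite quad_int. Qed.

Lemma conjD x y : K x -> K y -> cj (x + y) = cj x + cj y.
Proof.
by case=> a [b ->] [c [d ->]]; rewrite quadD !conj_quad quadD opprD.
Qed.

Lemma conjM x y : K x -> K y -> cj (x * y) = cj x * cj y.
Proof.
case=> a [b ->] [c [d ->]]; rewrite quadM !conj_quad quadM.
congr quad; ring.
Qed.

Lemma conj_int (m : int) : cj (m%:~R : R) = m%:~R.
Proof. by rewrite -quad_int conj_quad oppr0. Qed.

Lemma conjK x : K x -> cj (cj x) = x.
Proof. by case=> a [b ->]; rewrite !conj_quad opprK. Qed.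

Lemma conj_eq0 x : K x -> cj x = 0 -> x = 0.
Proof. by move=> Kx x0; rewrite -[x]conjK // x0 (conj_int 0). Qed.

Definition omega : R := if (D %% 4 == 1)%N then (w + 1) / 2 else w.

Lemma omegaE :
  omega = if (D %% 4 == 1)%N then q (1 / 2) (1 / 2) else q 0 1.
Proof.
rewrite /omega /quad; case: ifP => _.
  by rewrite fmorph_div /= rmorph1 ratr_nat; field.
by rewrite rmorph0 rmorph1 mul1r add0r.
Qed.

Lemma field_omega : K omega.
Proof. by rewrite omegaE; case: ifP => _; do 2!eexists. Qed.

Lemma conj_omega : cj omega = - xi R D.
Proof.
rewrite omegaE /xi; case: ifP => _; rewrite conj_quad /quad.
  by rewrite rmorphN /= fmorph_div /= rmorph1 ratr_nat; field.
by rewrite rmorph0 rmorphN rmorph1 mulN1r add0r.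
Qed.

Lemma integral_omega : integralOver (intr : int -> R) omega.
Proof.
rewrite /omega; case: ifP => D4.
  (* In this case [D %/ 4] is (D - 1) / 4. *)
  exists ('X^2 - 'X - ((D %/ 4)%:Z)%:P).
    by rewrite monicE lead_coefDl ?lead_coefDl ?lead_coefXn ?size_polyN
       ?size_polyXn ?size_polyX ?size_polyC // ?size_polyDl ?size_polyN
       ?size_polyXn ?size_polyX //; case: eqP.
  rewrite /root !rmorphB /= map_polyXn map_polyX map_polyC /= !hornerE /= -pmulrn.
  have : (D%:R : R) = (D %/ 4)%:R * 4 + 1.
    by rewrite -natrM natr1; congr _%:R; lia.
  by have := sqr_sqrtD; set v := w => <- E; apply/eqP; lra.
exists ('X^2 - (D%:Z)%:P).
  by rewrite monicE lead_coefDl ?lead_coefXn ?size_polyN ?size_polyXn ?size_polyC //; case: eqP.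
rewrite /root !rmorphB /= map_polyXn map_polyC /= !hornerE /= -pmulrn.
by have := sqr_sqrtD; set v := w => E; apply/eqP; lra.
Qed.

(** The minimal polynomial over the rationals divides every monic integer polynomial vanishing at
    the element, so its coefficients are integers. It is quadratic unless [b = 0], when it is X -
    a. *)
Lemma integer_quad_trace_norm (a b : rat) :
  integralOver (intr : int -> R) (q a b) ->
  2 * a \is a Num.int /\ a ^+ 2 - D%:R * b ^+ 2 \is a Num.int.
Proof.
case=> p pm; rewrite /root => /eqP p0.
have pE : map_poly intr p = map_poly (@ratr R) (map_poly intr p).
  by rewrite -map_poly_comp; apply: eq_map_poly => z /=; rewrite ratr_int.
have [b0|b0] := eqVneq b 0.
  have dv : ('X - a%:P) %| map_poly intr p.
    rewrite dvdp_XsubCl /root -(fmorph_eq0 (@ratr R)) -horner_map /= -pE.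
    by move: p0; rewrite b0 /quad rmorph0 mul0r addr0 => ->.
  have /(_ 0) := monic_rat_dvd_int (monicXsubC a) pm dv.
  rewrite coefB coefX coefC /= sub0r rpredN => ai.
  by rewrite b0 expr0n /= mulr0 subr0 rpredX ?rpredM ?rpred_nat.
have [t tE] : exists t, t = a ^+ 2 - D%:R * b ^+ 2 by eexists.
rewrite -tE.
pose f : {poly rat} := 'X^2 - (2 * a) *: 'X + t%:P.
have sf : (size (- ((2 * a) *: 'X) + t%:P : {poly rat})%R <= 2)%N.
  rewrite (leq_trans (size_polyD _ _)) // geq_max size_polyN.
  rewrite (leq_trans (size_scale_leq _ _)) ?size_polyX //=.
  by rewrite size_polyC; case: eqP.
have fm : f \is monic.
  rewrite /f -addrA monicE lead_coefDl ?lead_coefXn //.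
  by rewrite size_polyXn ltnS.
have dv : f %| map_poly intr p.
  (* The remainder has degree at most 1 and vanishes at an irrational element, so it is 0. *)
  rewrite /dvdp; set r := _ %% _.
  have sr : (size r <= 2)%N.
    have : (size r < size f)%N by rewrite ltn_modp monic_neq0.
    rewrite /f -addrA size_polyDl ?size_polyXn ?ltnS //.
  have fx : (map_poly (@ratr R) f).[q a b] = 0.
    rewrite /f !rmorphD /= rmorphN /= map_polyZ /= map_polyXn map_polyX map_polyC /=.
    rewrite !hornerE /= tE /quad rmorphB /= !rmorphM /= !ratr_nat.
    by have := sqr_sqrtD; set v := w => <-; ring.
  have rx : (map_poly (@ratr R) r).[q a b] = 0.
    move: p0; rewrite pE (divp_eq (map_poly intr p) f) -/r rmorphD rmorphM /=.
    by rewrite hornerD hornerM fx mulr0 add0r.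
  have rE : r = (r`_0)%:P + r`_1 *: 'X.
    apply/polyP => i; rewrite coefD coefC coefZ coefX.
    case: i => [|[|i]] /=; rewrite ?mulr0 ?mulr1 ?add0r ?addr0 //.
    by rewrite nth_default // (leq_trans sr).
  move: rx; rewrite rE rmorphD /= map_polyC map_polyZ /= map_polyX !hornerE /=.
  set r0 := r`_0; set r1 := r`_1.
  have -> : ratr r0 + ratr r1 * q a b = q (r0 + r1 * a) (r1 * b).
    by rewrite /quad rmorphD /= !rmorphM /=; ring.
  rewrite (_ : 0 = q 0 0); last by rewrite /quad !rmorph0 mul0r addr0.
  move/quad_inj => [E1 /eqP].
  rewrite mulf_eq0 (negPf b0) orbF => /eqP r10.
  by move: E1; rewrite r10 mul0r addr0 => ->; rewrite scale0r addr0.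
have fi := monic_rat_dvd_int fm pm dv.
split.
  have := fi 1%N.
  by rewrite /f !coefD coefN coefZ coefXn coefX coefC /= add0r mulr1 addr0 rpredN.
have := fi 0%N.
by rewrite /f !coefD coefN coefZ coefXn coefX coefC /= mulr0 subr0 add0r.
Qed.

(** Trace and norm make 2a and 2b integers [m] and [n] with m^2 - D n^2 divisible by 4; their
    parities then give the coordinates. *)
Lemma ring_of_integersP x :
  O x <-> exists m n : int, x = m%:~R + n%:~R * omega.
Proof.
split; last first.
  case=> m [n ->]; split.
    by apply: fieldD; [|apply: fieldM]; [exact: field_int..|exact: field_omega].
  apply: integral_add; first exact: integral_id.
  by apply: integral_mul; [exact: integral_id | exact: integral_omega].
case=> -[a [b ->]] /integer_quad_trace_norm[/intrP[m mE] tE].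
have bi : 2 * b \is a Num.int.
  apply: (@squarefree_rat_int D) => //; first lia.
  have -> : D%:R * (2 * b) ^+ 2 = (2 * a) ^+ 2 - 4 * (a ^+ 2 - D%:R * b ^+ 2) by ring.
  by rewrite mE rpredB //; [rewrite rpredX ?rpred_int | rewrite rpredM ?rpred_nat].
case/intrP: bi => n nE; case/intrP: tE => t tE.
have aE : a = m%:~R / 2 by lra.
have bE : b = n%:~R / 2 by lra.
have mnE : m ^+ 2 - D%:Z * n ^+ 2 = 4 * t.
  apply: (@intr_inj rat); rewrite intrM -tE rmorphB /= !rmorphM /= -mE -nE -!pmulrn; ring.
have D4 : (D %% 4 != 0)%N.
  apply/negP => D4; suff : 2%N = 1%N by [].
  by apply: hDsf; rewrite /dvdn.
pose m2 := (m %/ 2)%Z; pose n2 := (n %/ 2)%Z.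
have Em : m = m2 * 2 \/ m = m2 * 2 + 1 by rewrite /m2; lia.
have En : n = n2 * 2 \/ n = n2 * 2 + 1 by rewrite /n2; lia.
pose d := (D %/ 4)%N.
(* Modulo 4, [m] odd with [n] even is impossible, [m] even with [n] odd would give 4 | D, and both
   odd gives D = 1. *)
have key : if (D %% 4 == 1)%N then exists k, m = n + 2 * k
           else m = m2 * 2 /\ n = n2 * 2.
  case: Em En => Em [] En.
  - by case: ifP => // _; exists (m2 - n2); lia.
  - have := mnE; rewrite Em En => E.
    have {}E : 4 * (m2 ^+ 2 - D%:Z * (n2 ^+ 2 + n2) - t) = D%:Z by lra.
    by exfalso; move: E; set X := (X in 4 * X); lia.
  - have := mnE; rewrite Em En => E.
    have {}E : 4 * (t + D%:Z * n2 ^+ 2 - m2 ^+ 2 - m2) = 1 by lra.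
    by exfalso; move: E; set X := (X in 4 * X); lia.
  - have := mnE; rewrite Em En => E.
    have {}E : 4 * (m2 ^+ 2 + m2 - D%:Z * (n2 ^+ 2 + n2) - t) + 1 = D%:Z by lra.
    have D1 : (D %% 4 == 1)%N by move: E; set X := (X in 4 * X); lia.
    by rewrite D1; exists (m2 - n2); lia.
case: ifP key => Dm.
  case=> k mk; exists k, n; rewrite /omega Dm aE bE mk /quad.
  by rewrite !fmorph_div /= !ratr_int ratr_nat intrD intrM; field.
case=> mk nk; exists m2, n2; rewrite /omega Dm aE bE mk nk /quad.
by rewrite !fmorph_div /= !ratr_int ratr_nat !intrM; field.
Qed.

End QuadraticField.

(** * Continued fractions of irrational numbers *)

Section ContinuedFraction.
Variable R : realType.
Implicit Types x y : R.

Definition irrational x := forall a : rat, x != ratr a.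

Lemma complete_quotientD x m n :
  complete_quotient (complete_quotient x m) n = complete_quotient x (m + n).
Proof. by elim: n => [|n IH]; rewrite ?addn0 // addnS /= IH. Qed.

Lemma irrational_complete_quotient x n :
  irrational x -> irrational (complete_quotient x n).
Proof.
move=> irr; elim: n => //= n; set y := complete_quotient x n => IH a.
apply/eqP => /(congr1 GRing.inv); rewrite invrK -fmorphV => E.
have /eqP[] := IH (a^-1 + (Num.floor y)%:~R).
by rewrite rmorphD /= ratr_int -E subrK.
Qed.

Lemma irrational_fract x : irrational x ->
  0 < x - (Num.floor x)%:~R < 1.
Proof.
move=> irr; have /andP[f1 f2] := floor_itv x.
rewrite ltrBlDr subr_gt0 lt_neqAle f1 andbT.
have := irr (Num.floor x)%:~R; rewrite ratr_int eq_sym => -> /=.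
by move: f2; rewrite intrD addrC.
Qed.

Lemma complete_quotientS_gt1 x n : irrational x ->
  1 < complete_quotient x n.+1.
Proof.
move/(irrational_complete_quotient n)/irrational_fract => /= /andP[p0 p1].
by rewrite invf_gt1.
Qed.

Lemma partial_quotientS_ge1 x n : irrational x -> 1 <= partial_quotient x n.+1.
Proof.
by move=> irr; rewrite /partial_quotient floor_ge_int ltW // complete_quotientS_gt1.
Qed.

Lemma complete_quotientSr x n :
  complete_quotient x n =
  (partial_quotient x n)%:~R + (complete_quotient x n.+1)^-1.
Proof. by rewrite /= invrK addrC subrK. Qed.

(** Complete quotients with equal floors are at distance at most 1, and going back two indices
    divides the distance by at least 4. *)
Lemma partial_quotient_inj x y : irrational x -> irrational y ->
  partial_quotient x =1 partial_quotient y -> x = y.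
Proof.
move=> ix iy E.
pose d n : R := `|complete_quotient x n - complete_quotient y n|.
have d1 n : d n <= 1.
  have /andP[] := irrational_fract (irrational_complete_quotient n ix).
  have /andP[] := irrational_fract (irrational_complete_quotient n iy).
  have := E n; rewrite /partial_quotient => ->.
  set f := (_%:~R) => h1 h2 h3 h4; rewrite /d ler_norml; lra.
(* x_{n+1} x_{n+2} = u_{n+1} x_{n+2} + 1 >= 2, and the same for y, while
   x_n - y_n = - (x_{n+1} - y_{n+1}) / (x_{n+1} y_{n+1}). *)
have prod2 z n : irrational z ->
    2 <= complete_quotient z n.+1 * complete_quotient z n.+2.
  move=> iz; rewrite (complete_quotientSr z n.+1).
  have := complete_quotientS_gt1 n.+1 iz.
  have := partial_quotientS_ge1 n iz.
  set c := complete_quotient z n.+2.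
  rewrite -(ler_int R); set a := (partial_quotient _ _)%:~R => a1 c1.
  rewrite mulrDl mulVf; last lra.
  nra.
have step n : d n = d n.+1 / (complete_quotient x n.+1 * complete_quotient y n.+1).
  have := complete_quotientS_gt1 n ix; have := complete_quotientS_gt1 n iy.
  rewrite /d (complete_quotientSr x n) (complete_quotientSr y n) E.
  set a := complete_quotient x n.+1; set b := complete_quotient y n.+1 => a1 b1.
  have ab0 : 0 < a * b by apply: mulr_gt0; lra.
  rewrite -[in RHS](gtr0_norm ab0) -normf_div distrC; congr `|_|.
  field; apply/andP; split; lra.
have d4 n : d n <= d n.+2 / 4.
  rewrite step step.
  have dn : 0 <= d n.+2 by rewrite normr_ge0.
  have := prod2 x n ix; have := prod2 y n iy.
  have := complete_quotientS_gt1 n ix; have := complete_quotientS_gt1 n iy.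
  have := complete_quotientS_gt1 n.+1 ix; have := complete_quotientS_gt1 n.+1 iy.
  move: dn; set e := d n.+2.
  set a := complete_quotient x n.+1; set b := complete_quotient y n.+1.
  set a' := complete_quotient x n.+2; set b' := complete_quotient y n.+2.
  move=> e0 b'1 a'1 b1 a1 bb aa.
  rewrite -mulrA -invfM ler_wpM2l // lef_pV2 ?posrE //; last first.
    by rewrite !mulr_gt0 // (lt_trans ltr01).
  have -> : a' * b' * (a * b) = a * a' * (b * b') by ring.
  nra.
(* A linear bound is enough: the Archimedean property turns it into [d 0 = 0]. *)
have dm m n : d n * m%:R <= 1.
  elim: m n => [|m IH] n; first by rewrite mulr0.
  have := IH n.+2; have := d4 n; have := d1 n.+2.
  have : 0 <= d n by rewrite normr_ge0.
  rewrite -(natr1 m); set p := d n; set q := d n.+2; have : (0 : R) <= m%:R by rewrite ler0n.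
  set M := m%:R => M0 p0 q1 pq qM.
  have : 0 <= (q / 4 - p) * M by rewrite mulr_ge0 ?subr_ge0.
  lra.
apply/eqP; rewrite -subr_eq0 -normr_eq0; apply/negPn/negP => d0.
have {}d0 : 0 < d 0%N by rewrite lt_neqAle eq_sym d0 normr_ge0.
have := dm (Num.truncn (d 0%N)^-1).+1 0%N.
apply/negP; rewrite -ltNge -ltr_pdivrMl // mulr1.
exact: truncnS_gt.
Qed.

(** Periodicity is given for the partial quotients only; it passes to the complete quotients because
    these are determined by their expansions. *)
Lemma complete_quotient_period x T : irrational x ->
  periodic_after0 (partial_quotient x) T ->
  complete_quotient x T.+1 = complete_quotient x 1.
Proof.
move=> ix [_ per]; apply: partial_quotient_inj; try exact: irrational_complete_quotient.
move=> n; rewrite /partial_quotient !complete_quotientD.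
have := per (1 + n)%N isT; rewrite /partial_quotient.
by rewrite (_ : (1 + n + T = T.+1 + n)%N) //; lia.
Qed.

End ContinuedFraction.

(** * Continuants of [xi]: signs, conjugates and bases *)

Section PrincipalIdeal.
Variables (R : realType) (D : nat).
Hypotheses (hD1 : (1 < D)%N) (hDsf : squarefree D).
Local Notation K := (@quadratic_field R D).
Local Notation O := (@ring_of_integers R D).
Local Notation O0 := (totally_positive0 D O).
Local Notation cj := (conjugate D).
Local Notation xi := (xi R D).
Local Notation omega := (omega R D).
Local Notation u := (partial_quotient xi).

Lemma integers_field x : O x -> K x.
Proof. by case. Qed.

Lemma integersD x y : O x -> O y -> O (x + y).
Proof.
move=> [Kx Ix] [Ky Iy]; split; first exact: fieldD.
exact: integral_add.
Qed.

Lemma integersM x y : O x -> O y -> O (x * y).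
Proof.
move=> [Kx Ix] [Ky Iy]; split; first exact: fieldM.
exact: integral_mul.
Qed.

Lemma integers_int (m : int) : O m%:~R.
Proof. by split; [exact: field_int | exact: integral_id]. Qed.

Lemma integers_omega : O omega.
Proof. by split; [exact: field_omega | exact: integral_omega]. Qed.

(** A rational [xi] would give the conjugate of [omega] no component along the square root. *)
Lemma irrational_xi : irrational xi.
Proof.
move=> a; apply/eqP => E.
have : cj omega = quad R D (- a) 0.
  by rewrite conj_omega // E /quad rmorph0 mul0r addr0 rmorphN.
by rewrite omegaE; case: ifP => _; rewrite conj_quad // => /(quad_inj hD1 hDsf)[].
Qed.

Lemma sqrtD_gt1 : 1 < Num.sqrt D%:R :> R.
Proof.
have D1 : 1 < D%:R :> R by rewrite ltr1n.
by rewrite -[ltLHS]sqrtr1 ltr_sqrt // (lt_trans ltr01).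
Qed.

Lemma xi_gt0 : 0 < xi.
Proof.
have s1 := sqrtD_gt1.
rewrite /Defs.xi; case: ifP => _; lra.
Qed.

Lemma omega_gt0 : 0 < omega.
Proof.
have s1 := sqrtD_gt1.
rewrite /omega; case: ifP => _; lra.
Qed.

(* continuant_pair z n = (p_{n-1} + q_{n-1} z, p_n + q_n z), where p_n / q_n are
   the convergents of xi and (p_{-1}, q_{-1}) = (1, 0). *)
Fixpoint continuant_pair (z : R) (n : nat) : R * R :=
  if n is m.+1 then
    let p := continuant_pair z m in (p.2, (u m.+1)%:~R * p.2 + p.1)
  else (1, (u 0)%:~R + z).

Definition continuant z n := (continuant_pair z n).1.

Lemma continuantSS z n :
  continuant z n.+2 = (u n.+1)%:~R * continuant z n.+1 + continuant z n.
Proof. by []. Qed.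

Local Notation A := (continuant omega).
Local Notation B := (continuant (- xi)).

Lemma nat_ind2 (P : nat -> Prop) :
  P 0%N -> P 1%N -> (forall n, P n -> P n.+1 -> P n.+2) -> forall n, P n.
Proof.
move=> P0 P1 PS n; suff [] : P n /\ P n.+1 by [].
by elim: n => // n [? ?]; split=> //; apply: PS.
Qed.

Lemma partial_quotient_gt0 n : 0 < u n.+1.
Proof. by have := partial_quotientS_ge1 n irrational_xi; lia. Qed.

Lemma integers_continuant n : O (A n).
Proof.
elim/nat_ind2: n => [||n ? ?]; first exact: (integers_int 1).
  by apply: integersD; [exact: integers_int | exact: integers_omega].
rewrite continuantSS; apply: integersD => //; apply: integersM => //.
exact: integers_int.
Qed.

(** Conjugation fixes the integer coefficients of the recurrence and sends [omega] to [- xi]. *)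
Lemma conj_continuant n : cj (A n) = B n.
Proof.
elim/nat_ind2: n => [||n E1 E2]; first exact: (conj_int R hD1 hDsf 1).
  rewrite /continuant /= conjD ?conj_int ?conj_omega //.
    exact: field_int.
  exact: field_omega.
rewrite !continuantSS conjD ?conjM ?conj_int ?E1 ?E2 //;
  try apply: fieldM; try exact: field_int; exact/integers_field/integers_continuant.
Qed.

Lemma conj_continuant_comb n (a b : int) :
  cj (a%:~R * A n + b%:~R * A n.+1) = a%:~R * B n + b%:~R * B n.+1.
Proof.
have KA m : K (A m) by exact/integers_field/integers_continuant.
have KM (c : int) m : K (c%:~R * A m) by apply: fieldM => //; exact: field_int.
by rewrite conjD // !conjM ?conj_int ?conj_continuant //; exact: field_int.
Qed.

Lemma continuant_gt0 n : 0 < A n.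
Proof.
elim/nat_ind2: n => [||n ? ?]; first exact: ltr01.
  apply: ltr_wpDl; last exact: omega_gt0.
  by rewrite ler0z floor_ge0 ltW ?xi_gt0.
by rewrite continuantSS addr_gt0 // mulr_gt0 // ltr0z partial_quotient_gt0.
Qed.

(** This is xi = (p_n x + p_{n-1}) / (q_n x + q_{n-1}), for x the complete quotient of index n + 1,
    with denominators cleared. *)
Lemma continuant_complete_quotient n :
  B n.+1 * complete_quotient xi n.+1 = - B n.
Proof.
elim: n => [|n IH].
  have /andP[f0 _] := irrational_fract irrational_xi.
  rewrite /continuant /= /partial_quotient /= -opprB mulNr divff //.
  by rewrite gt_eqF.
have /andP[f0 _] :=
  irrational_fract (irrational_complete_quotient n.+1 irrational_xi).
rewrite continuantSS -[B n]opprK -IH.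
rewrite -[complete_quotient xi n.+2]/((complete_quotient xi n.+1 - (u n.+1)%:~R)^-1).
rewrite -/(u n.+1) in f0; set c := complete_quotient xi n.+1 in f0 *.
by field; rewrite gt_eqF.
Qed.

(** The ratio of [B n] to [B n.+1] is minus a complete quotient, hence negative, and [B 0 = 1]. *)
Lemma sign_continuant n : 0 < (-1) ^+ n * B n.
Proof.
elim: n => [|n IH]; first by rewrite mul1r ltr01.
have c0 : 0 < complete_quotient xi n.+1.
  exact/(lt_trans ltr01)/complete_quotientS_gt1/irrational_xi.
rewrite -(pmulr_lgt0 _ c0) -mulrA continuant_complete_quotient exprS; lra.
Qed.

(** The change of basis from one consecutive pair to the next has determinant -1. *)
Lemma integers_basis n x :
  O x -> exists a b : int, x = a%:~R * A n + b%:~R * A n.+1.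
Proof.
move=> Ox; elim: n => [|n [a [b ->]]].
  have [m [k ->]] := (ring_of_integersP hD1 hDsf x).1 Ox.
  exists (m - k * u 0), k; rewrite /continuant /= rmorphB /= intrM; ring.
exists (b - a * u n.+1), a; rewrite continuantSS rmorphB /= intrM; ring.
Qed.

(** * The unit attached to a period, and cones over the totally positive integers *)

Section Period.
Variable T : nat.
Hypothesis hT : periodic_after0 u T.

(** Both sides satisfy the same recurrence in [n]. They agree at 0 since [B 0 = 1], and at 1 since
    the complete quotients of indices [T.+1] and 1 coincide. *)
Lemma conj_continuant_period n : B (T + n) = B T * B n.
Proof.
case: hT => T0 per; elim/nat_ind2: n => [||n E1 E2].
- by rewrite addn0 /continuant /= mulr1.
- have /(congr1 (fun x => B T.+1 * x)) := complete_quotient_period irrational_xi hT.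
  rewrite continuant_complete_quotient addn1 => E.
  have c0 : complete_quotient xi 1 != 0.
    by rewrite gt_eqF // (lt_trans ltr01) // complete_quotientS_gt1 //; exact: irrational_xi.
  apply: (mulIf c0); rewrite -E -mulrA continuant_complete_quotient.
  by rewrite /continuant /= mulrN1.
- have pern : u (T + n).+1 = u n.+1 by rewrite -(per n.+1) // addSn addnC.
  by rewrite !addnS !continuantSS pern -addnS E1 E2; ring.
Qed.

Lemma continuant_period n : A (T + n) = A T * A n.
Proof.
have KA m : K (A m) by exact/integers_field/integers_continuant.
rewrite -[LHS](conjK hD1 hDsf) // conj_continuant conj_continuant_period.
by rewrite -!conj_continuant -conjM ?conjK //; apply: fieldM.
Qed.

Hypothesis evT : ~~ odd T.

(** Writing 1 in the basis [A T], [A T.+1] and factoring out [A T] exhibits the inverse. As [T] is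
    even, [B T] is positive, which makes the inverse totally positive. *)
Lemma unit_inverse : exists2 eta, O0 eta & A T * eta = 1.
Proof.
have [a [b E]] := integers_basis T (integers_int 1).
have E1 : A T * (a%:~R * A 0 + b%:~R * A 1) = 1.
  by rewrite -[RHS]/(1%:~R) E -(addn1 T) continuant_period [A 0]/continuant /=; ring.
exists (a%:~R * A 0 + b%:~R * A 1) => //; set eta := (X in A T * X) in E1 *.
have Oeta : O eta.
  by apply: integersD; apply: integersM; try exact: integers_int;
    exact: integers_continuant.
left; split => //.
  by rewrite -(pmulr_rgt0 _ (continuant_gt0 T)) E1 ltr01.
have BT : 0 < B T.
  by have := sign_continuant T; rewrite -signr_odd (negPf evT) mul1r.
rewrite -(pmulr_rgt0 _ BT) -conj_continuant -conjM ?E1 ?(conj_int R hD1 hDsf 1) //.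
  exact/integers_field/integers_continuant.
exact: integers_field.
Qed.

Lemma continuant_period_conj_gt0 : 0 < cj (A T).
Proof.
have := sign_continuant T.
by rewrite -signr_odd (negPf evT) mul1r conj_continuant.
Qed.

Lemma totally_positive0_integersD x y : O0 x -> O0 y -> O0 (x + y).
Proof.
move=> [[Ox x0 x0']|->]; last by rewrite add0r.
move=> [[Oy y0 y0']|->]; last by rewrite addr0; left.
left; split; first exact: integersD.
  exact: addr_gt0.
by rewrite conjD ?addr_gt0 //; exact: integers_field.
Qed.

Lemma totally_positive0_integersM x y : O0 x -> O0 y -> O0 (x * y).
Proof.
move=> [[Ox x0 x0']|->]; last by rewrite mul0r; right.
move=> [[Oy y0 y0']|->]; last by rewrite mulr0; right.
left; split; first exact: integersM.
  exact: mulr_gt0.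
by rewrite conjM ?mulr_gt0 //; exact: integers_field.
Qed.

Lemma totally_positive0_nat n : O0 n%:R.
Proof.
case: n => [|n]; first by right.
left; rewrite pmulrn; split; first exact: integers_int.
  by rewrite ltr0z.
by rewrite conj_int // ltr0z.
Qed.

Definition spanned (l : seq R) (y : R) := exists x : 'I_(size l) -> R,
  (forall i, O0 (x i)) /\ y = \sum_(i < size l) l`_i * x i.

Lemma spannedD l y z : spanned l y -> spanned l z -> spanned l (y + z).
Proof.
move=> [x [Ox ->]] [x' [Ox' ->]]; exists (fun i => x i + x' i); split.
  by move=> i; apply: totally_positive0_integersD.
by rewrite -big_split /=; apply: eq_bigr => i _; rewrite mulrDr.
Qed.

Lemma spannedM l y z : spanned l y -> O0 z -> spanned l (y * z).
Proof.
move=> [x [Ox ->]] Oz; exists (fun i => x i * z); split.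
  by move=> i; apply: totally_positive0_integersM.
by rewrite mulr_suml; apply: eq_bigr => i _; rewrite mulrA.
Qed.

Lemma spanned_mem l y : y \in l -> spanned l y.
Proof.
move=> yl; have il : (index y l < size l)%N by rewrite index_mem.
exists (fun i => (i == Ordinal il)%:R); split.
  by move=> i; apply: totally_positive0_nat.
rewrite (bigD1 (Ordinal il)) //= eqxx mulr1 nth_index // big1 ?addr0 // => i.
by move/negPf => ->; rewrite mulr0.
Qed.

(** * Generators of the totally positive part of the ideal, and their number *)

Section Parity.
Variables (e : bool) (alpha : R).
Hypotheses (halphaK : K alpha) (halpha : 0 < alpha)
  (halpha' : 0 < (-1) ^+ e * cj alpha).

(** The value [r = u i.+1] is left out because it gives [A i.+2], the element with [r = 0] at the
    next index of the same parity. *)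
Definition generators : seq R :=
  [seq alpha * (A i + r%:R * A i.+1)
     | i <- [seq i <- iota 0 T | odd i == e], r <- iota 0 `|u i.+1|%N].

(** An index beyond [T] is lowered by [T] at the cost of the totally positive factor [A T]. *)
Lemma spanned_generator n r : odd n = e -> (r%:Z < u n.+1) ->
  spanned generators (alpha * (A n + r%:R * A n.+1)).
Proof.
have [T0 per] := hT.
elim/ltn_ind: n r => n IH r ne ru.
have [nT|Tn] := ltnP n T.
  apply: spanned_mem; apply/allpairsPdep; exists n, r; split=> //.
    by rewrite mem_filter ne eqxx mem_iota.
  by rewrite mem_iota /= add0n; have := partial_quotient_gt0 n; lia.
have nE : n = (T + (n - T))%N by rewrite subnKC.
set m := (n - T)%N in nE.
have mn : (m < n)%N by lia.
have -> : alpha * (A n + r%:R * A n.+1) = alpha * (A m + r%:R * A m.+1) * A T.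
  by rewrite nE -addnS !continuant_period; ring.
apply: spannedM; last first.
  by left; split; [exact: integers_continuant | exact: continuant_gt0
    | exact: continuant_period_conj_gt0].
apply: IH => //.
  by move: ne; rewrite nE oddD (negPf evT).
by rewrite -(per m.+1) // addSn addnC -nE.
Qed.

Lemma spanned_generator_le n r : odd n = e -> (r%:Z <= u n.+1) ->
  spanned generators (alpha * (A n + r%:R * A n.+1)).
Proof.
move=> ne; rewrite le_eqVlt => /predU1P[rE|]; last exact: spanned_generator.
have -> : A n + r%:R * A n.+1 = A n.+2 + 0%:R * A n.+3.
  by rewrite mul0r addr0 continuantSS -rE -pmulrn addrC.
by apply: spanned_generator; [rewrite /= negbK | exact: partial_quotient_gt0].
Qed.

(** With b = q a + t, the element is a - t times the generator of slope q plus t times that of slope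
    q + 1. *)
Lemma spanned_cone n (a b : nat) : odd n = e -> (0 < a)%N ->
  (b%:Z <= u n.+1 * a%:Z) ->
  spanned generators (alpha * (a%:R * A n + b%:R * A n.+1)).
Proof.
move=> ne a0 bu; pose q := (b %/ a)%N; pose t := (b %% a)%N.
have ta : (t < a)%N by rewrite ltn_mod.
have bE : b = (q * a + t)%N by exact: divn_eq.
have qu : q%:Z <= u n.+1 by rewrite -(ler_pM2r (_ : 0 < a%:Z)) //; lia.
have aR : a%:R = (a - t)%:R + t%:R :> R by rewrite -natrD subnK // ltnW.
have bR : b%:R = q%:R * a%:R + t%:R :> R by rewrite -natrM -natrD -bE.
have -> : alpha * (a%:R * A n + b%:R * A n.+1) =
    alpha * (A n + q%:R * A n.+1) * (a - t)%:R +
    alpha * (A n + q.+1%:R * A n.+1) * t%:R.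
  by rewrite bR aR -(natr1 q); ring.
apply: spannedD.
  by apply: spannedM (totally_positive0_nat _); exact: spanned_generator_le.
(* If [t = 0], then [q] may equal [u n.+1] and slope q + 1 is out of range, but its coefficient is
   0. If [t > 0], then [q < u n.+1]. *)
have [t0|t0] := posnP t.
  rewrite t0 mulr0 -[0](mulr0 (alpha * (A n + 0%:R * A n.+1))).
  apply: spannedM (totally_positive0_nat 0); apply: spanned_generator_le => //.
  exact/ltW/partial_quotient_gt0.
apply: spannedM (totally_positive0_nat _); apply: spanned_generator_le => //.
rewrite -ltzD1 -(ltr_pM2r (_ : 0 < a%:Z)) //; lia.
Qed.

(** [A n] and [A n.+1] are positive with conjugates of opposite signs. If [a <= 0], positivity of
    the element forces [b > 0], and then its conjugate has the wrong sign. *)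
Lemma coordinate_gt0 n (a b : int) : odd n = e ->
  0 < a%:~R * A n + b%:~R * A n.+1 ->
  0 < (-1) ^+ e * (a%:~R * B n + b%:~R * B n.+1) -> 0 < a.
Proof.
move=> ne y0; rewrite -ne signr_odd => y0'; rewrite ltNge; apply/negP => a0.
have := sign_continuant n; have := sign_continuant n.+1; rewrite exprS.
have := continuant_gt0 n; have := continuant_gt0 n.+1.
have {}a0 : a%:~R <= 0 :> R by rewrite lerz0.
move: a0 y0 y0'; set sg := (-1) ^+ n; move: (a%:~R) (b%:~R) => x z.
move: (A n) (A n.+1) => P Q; rewrite mulrDr !(mulrCA sg) mulN1r mulNr.
move: (sg * B n) (sg * B n.+1) => p q x0 y0 y0' Q0 P0 q0 p0.
have [z0|z0] := leP z 0; nra.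
Qed.

Lemma spanned_of_signs (a : nat) n y : odd n = e -> O y -> 0 < y ->
  0 < (-1) ^+ e * cj y ->
  (exists b : int, y = a%:R * A n + b%:~R * A n.+1) ->
  spanned generators (alpha * y).
Proof.
have [T0 per] := hT; have [eta Oeta epseta] := unit_inverse.
have OA := integers_continuant.
elim/ltn_ind: a n y => a IH n y ne Oy y0 y0' [b yE].
(* Any basis of the right parity with a smaller first coordinate will do: that coordinate is
   positive by [coordinate_gt0], so the descent stays in the naturals. *)
have next n' z (c d : int) : odd n' = e -> O z -> 0 < z ->
    0 < (-1) ^+ e * cj z -> z = c%:~R * A n' + d%:~R * A n'.+1 ->
    (c < a%:Z) -> spanned generators (alpha * z).
  move=> ne' Oz z0 z0' zE ca.
  have c0 : 0 < c by apply: (@coordinate_gt0 n' c d) => //; rewrite -?conj_continuant_comb -zE.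
  apply: (IH `|c|%N _ n') => //; first lia.
  by exists d; rewrite zE pmulrn gez0_abs // ltW.
have a0 : 0 < a%:Z.
  by apply: (@coordinate_gt0 n a b) => //; rewrite -?conj_continuant_comb -?pmulrn -yE.
have ua : 0 < u n.+1 by exact: partial_quotient_gt0.
have [b0|b0] := ltP b 0; last first.
  have [bu|bu] := leP b (u n.+1 * a%:Z).
    rewrite yE -(gez0_abs b0) -pmulrn; apply: spanned_cone => //.
    by rewrite gez0_abs.
  (* Substitute [A n = A n.+2 - u n.+1 * A n.+1], then [A n.+1 = A n.+3 - u n.+2 * A n.+2]. *)
  apply: (next n.+2 y (a%:Z - u n.+2 * (b - u n.+1 * a%:Z)) (b - u n.+1 * a%:Z)) => //.
  - by rewrite /= negbK.
  - by rewrite yE !continuantSS !(intrM, rmorphB) /= -pmulrn; ring.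
  - have : 0 < u n.+2 * (b - u n.+1 * a%:Z).
      by rewrite mulr_gt0 ?subr_gt0 ?partial_quotient_gt0.
    lia.
(* The index n may be too small to step down from: multiplying y by the unit A T
   first raises it by T. *)
have -> : alpha * y = alpha * (A T * y) * eta.
  by rewrite [A T * y]mulrC !mulrA -[_ * A T * eta]mulrA epseta mulr1.
apply: spannedM => //.
(* [T] is positive and even, hence at least 2. *)
have [m mE] : exists m, (T + n = m.+2)%N.
  by exists (T + n).-2; case: (T) T0 evT => [|[|t]].
have me : odd m = e by rewrite -ne -[odd m]negbK -/(odd m.+2) -mE oddD (negPf evT).
have KT : K (A T) by exact/integers_field/OA.
have AT0 := continuant_gt0 T.
(* Expanding [A m.+3] and then [A m.+2] gives these coordinates; the first one drops since
   [b < 0]. *)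
apply: (next m _ (a%:Z + u m.+2 * b) (b + (a%:Z + u m.+2 * b) * u m.+1)) => //.
- exact: integersM.
- exact: mulr_gt0.
- rewrite conjM //; last exact: integers_field.
  by rewrite mulrCA mulr_gt0 // continuant_period_conj_gt0.
- rewrite yE mulrDr !(mulrCA (A T)) -!continuant_period addnS mE !continuantSS.
  by rewrite !(intrM, rmorphD) /= -pmulrn; ring.
- have : u m.+2 * b < 0 by rewrite nmulr_llt0 ?partial_quotient_gt0.
  lia.
Qed.

(** The conjugate of [A i + r * A i.+1] lies between [B i] and [B i.+2], which share the sign
    (-1)^e; this sign cancels that of the conjugate of [alpha]. *)
Lemma generator_totally_positive g : g \in generators ->
  exists2 h, g = alpha * h & O h /\ totally_positive D K g.
Proof.
case/allpairsPdep => i [r [+ + ->]]; rewrite mem_filter => /andP[/eqP ie _].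
rewrite mem_iota /= add0n => ru.
have {}ru : r%:Z < u i.+1 by have := partial_quotient_gt0 i; lia.
have Oh : O (A i + r%:R * A i.+1).
  rewrite pmulrn; apply: integersD; first exact: integers_continuant.
  by apply: integersM; [exact: integers_int | exact: integers_continuant].
exists (A i + r%:R * A i.+1) => //; split=> //.
have Kh := integers_field Oh.
split; first exact: fieldM.
  rewrite mulr_gt0 // ltr_wpDr ?continuant_gt0 // mulr_ge0 ?ler0n //.
  exact/ltW/continuant_gt0.
rewrite conjM //.
have -> : cj (A i + r%:R * A i.+1) = B i + r%:R * B i.+1.
  by rewrite -[A i]mul1r pmulrn (conj_continuant_comb i 1) mul1r.
have -> x : cj alpha * x = ((-1) ^+ e * cj alpha) * ((-1) ^+ e * x).
  by rewrite mulrACA -expr2 sqrr_sign mul1r.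
rewrite mulr_gt0 // -ie signr_odd.
have := sign_continuant i.+2; have := sign_continuant i.+1.
rewrite continuantSS !exprS mulrA mulrNN mulr1 mul1r.
have : r%:R <= (u i.+1)%:~R :> R by rewrite pmulrn ler_int ltW.
set sg := (-1) ^+ i; rewrite !mulrDr !(mulrCA sg) mulN1r mulNr.
move: (sg * B i) (sg * B i.+1) => p q; move: (r%:R) (_%:~R) => x y.
nra.
Qed.

Lemma spanned_generators :
  totally_positive0 D (principal_ideal D alpha) = [set y | spanned generators y].
Proof.
have sgE x : cj alpha * x = ((-1) ^+ e * cj alpha) * ((-1) ^+ e * x).
  by rewrite mulrACA -expr2 sqrr_sign mul1r.
apply/seteqP; split => y /=.
  case=> [[[z Oz <-] y0 y0']|->]; last first.
    exists (fun => 0); split; first by move=> i; right.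
    by rewrite big1 // => i _; rewrite mulr0.
  have z0 : 0 < z by rewrite -(pmulr_rgt0 _ halpha).
  have z0' : 0 < (-1) ^+ e * cj z.
    by rewrite -(pmulr_rgt0 _ halpha') -sgE -conjM //; exact: integers_field.
  (* The descent may start at any index of parity [e]; the boolean itself, read as 0 or 1, is
     one. *)
  have [a [b zE]] := integers_basis e Oz.
  have ee : odd e = e by case: e.
  have a0 : 0 < a.
    by apply: (@coordinate_gt0 e a b) => //; rewrite -?conj_continuant_comb -zE.
  apply: (@spanned_of_signs `|a|%N e) => //.
  by exists b; rewrite zE pmulrn gez0_abs // ltW.
case=> x [Ox ->].
elim/big_rec: _ => [|i z _ Iz]; first by right.
have /generator_totally_positive[h gE [Oh [Kg g0 g0']]] :
  generators`_i \in generators by exact: mem_nth.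
case: (Ox i) => [[Oxi x0 x0']|->]; last by rewrite mulr0 add0r.
have Kxi := integers_field Oxi.
have Iy : totally_positive D (principal_ideal D alpha) (generators`_i * x i).
  split; last by rewrite conjM // mulr_gt0.
    by exists (h * x i); [exact: integersM | rewrite gE mulrA].
  exact: mulr_gt0.
case: Iz => [[[z' Oz' zE] z0 z0']|->]; last by rewrite addr0; left.
case: Iy => [[y' Oy' yE] y0 y0'].
left; split; first by exists (y' + z'); [exact: integersD | rewrite mulrDr yE zE].
  exact: addr_gt0.
rewrite conjD ?addr_gt0 //; first exact: fieldM.
by rewrite -zE; apply: fieldM => //; exact: integers_field.
Qed.

Lemma generated_by_generators :
  generated_by D (principal_ideal D alpha) (size generators).
Proof.
exists (fun i => generators`_i); split; last exact: spanned_generators.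
by move=> i; have [h _ []] := generator_totally_positive (mem_nth 0 (ltn_ord i)).
Qed.

(** Index [i] contributes [u i.+1] generators; the shift by one turns parity [e] into [~~ e]. *)
Lemma size_generators :
  (size generators)%:Z = \sum_(1 <= i < T.+1 | odd i == ~~ e) u i.
Proof.
rewrite size_allpairs_dep sumnE big_map big_filter big_add1 /= -/(index_iota 0 T).
rewrite (big_morph _ PoszD (erefl _)).
rewrite /index_iota subn0; apply: eq_big => i; first by case: e; case: (odd i).
by move=> _; rewrite size_iota gez0_abs // ltW // partial_quotient_gt0.
Qed.

End Parity.

End Period.
End PrincipalIdeal.

Lemma generated_by_kappa (R : realType) (D : nat) (I : set R) (n : nat) :
  generated_by D I n -> exists2 k, is_kappa D I k & (k <= n)%N.
Proof.
move=> gn; pose P k := `[< generated_by D I k >].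
have exP : exists k, P k by exists n; apply/asboolP.
case: (ex_minnP exP) => k /asboolP gk kmin; exists k; last exact/kmin/asboolP.
by split=> // m gm; apply/kmin/asboolP.
Qed.

(* An odd period s exchanges the two parities, so that two periods contain
   every u_i, i <= s, exactly once with index of a given parity. *)
Lemma sum_parity_double_period (u : nat -> int) (s : nat) (c : bool) :
  periodic_after0 u s -> odd s ->
  \sum_(1 <= i < s.*2.+1 | odd i == c) u i = \sum_(1 <= i < s.+1) u i.
Proof.
move=> [s0 per] os.
rewrite (big_cat_nat _ (n := s.+1)) //=; last lia.
rewrite [RHS](bigID (fun i => odd i == c)) /=; congr (_ + _).
rewrite -{1}[s.+1]add1n big_addn (_ : s.*2.+1 - s = s.+1)%N; last lia.
rewrite big_nat_cond [RHS]big_nat_cond; apply: eq_big => i.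
  by rewrite oddD os addbT; case: (odd i) (c) => [] [].
by case/andP => /andP[i0 _] _; rewrite per.
Qed.

Theorem proposition3p9 (R : realType) (D : nat) (hD1 : (1 < D)%N)
    (hDsf : squarefree D) (u : nat -> int)
    (hu : u = partial_quotient (xi R D)) (s : nat) (hs : minimal_period u s)
    (alpha : R) (halphaK : quadratic_field D alpha) (halpha : 0 < alpha) :
  exists2 k : nat, is_kappa D (principal_ideal D alpha) k &
    [/\ odd s -> k%:Z <= \sum_(1 <= i < s.+1) u i,
        ~~ odd s -> 0 < conjugate D alpha ->
          k%:Z <= \sum_(1 <= i < s.+1 | odd i) u i
      & ~~ odd s -> conjugate D alpha < 0 ->
          k%:Z <= \sum_(1 <= i < s.+1 | ~~ odd i) u i].
Proof.
have [per _] := hs; have [s0 peru] := per.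
pose T := if odd s then s.*2 else s.
have evT : ~~ odd T by rewrite /T; case: ifP => [_|->] //; rewrite odd_double.
have perT : periodic_after0 u T.
  rewrite /T; case: ifP => // _; split=> [|i i0]; first by rewrite double_gt0.
  by rewrite -addnn addnA !peru // ltn_addr.
pose e := conjugate D alpha < 0.
have c0 : conjugate D alpha != 0.
  apply/eqP => /(conj_eq0 hD1 hDsf halphaK) a0.
  by rewrite a0 ltxx in halpha.
have halpha' : 0 < (-1) ^+ e * conjugate D alpha.
  rewrite /e; have [h|h] := ltP (conjugate D alpha) 0.
    by rewrite mulN1r oppr_gt0.
  by rewrite mul1r lt_neqAle eq_sym c0.
rewrite hu in perT.
have gen := generated_by_generators hD1 hDsf perT evT halphaK halpha halpha'.
have [k kk kle] := generated_by_kappa gen.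
exists k => //; have {kle} : k%:Z <= \sum_(1 <= i < T.+1 | odd i == ~~ e) u i.
  by rewrite hu -(size_generators hD1 hDsf T e alpha) lez_nat.
(* A positive conjugate makes [e] false and selects odd indices; a negative one selects even
   indices. *)
rewrite /T; case: ifP => os kle; split=> //.
- by rewrite sum_parity_double_period in kle.
- move=> _ h; move: kle; rewrite /e ltNge (ltW h) /=.
  by under eq_bigl do rewrite eqb_id.
- move=> _ h; move: kle; rewrite /e h /=.
  by under eq_bigl do rewrite eqbF_neg.
Qed.
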